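(* The inertial observer space $\overline{O}$ of de Sitter spacetime $S^{3,1}$ is isomorphic as a $G$-space to the space of ordered pairs of distinct points in $P(\mathcal{C})$, with $G=\mathrm{SO}_o(4,1)$ acting diagonally.
   Context: Let $\mathbb{R}^{4,1}$ be $\mathbb{R}^5$ with the Minkowski inner product $\eta=\mathrm{diag}(-1,1,1,1,1)$, and let $G=\mathrm{SO}_o(4,1)$ be the identity component of its linear isometry group. De Sitter spacetime is $S^{3,1}=\{x\in\mathbb{R}^{4,1}:\eta(x,x)=1\}$ with the Lorentzian metric induced by $\eta$ and the time orientation induced from $\mathbb{R}^{4,1}$. The projective light cone $P(\mathcal{C})$ is the space of one-dimensional null subspaces of $\mathbb{R}^{4,1}$ (a 3-sphere). $G$ acts on all of these. An inertial observer is a (maximal, unparametrized) timelike geodesic in $S^{3,1}$; explicitly, these are the curves $\gamma(\mathbb{R})$ with $\gamma(\tau)=(\cosh\tau)x+(\sinh\tau)u$, where $\eta(x,x)=1$, $\eta(u,u)=-1$, $u_0>0$, $\eta(x,u)=0$. The inertial observer space $\overline{O}$ is the set of all of these, with the induced $G$-action. All spaces involved are homogeneous $G$-spaces, with manifold structure that of $G$ modulo a closed stabilizer; ''isomorphic as a $G$-space'' means there is a $G$-equivariant diffeomorphism. *)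

(* Defs.v *)
From HB Require Import structures.
From mathcomp Require Import all_boot all_order all_algebra.
From mathcomp Require Import all_classical all_reals all_analysis.

Set Implicit Arguments.
Unset Strict Implicit.
Unset Printing Implicit Defensive.

Import Order.TTheory GRing.Theory Num.Theory.
Import numFieldNormedType.Exports.

Local Open Scope classical_set_scope.
Local Open Scope ring_scope.

Section SmoothFunctions.
Context {R : realType} {V : normedModType R}.

Fixpoint Ck_on (k : nat) (O : set V) (F : V -> R^o) : Prop :=
  match k with
  | 0%N => forall x, O x -> {for x, continuous F}
  | k'.+1 => (forall x, O x -> differentiable F x) /\
             (forall v : V, Ck_on k' O (fun x => 'D_v F x))
  end.

Definition smooth_on (O : set V) (F : V -> R^o) : Prop :=
  forall k, Ck_on k O F.

(* Relatively open subsets of a subset of V, and smooth functions on them: for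
   an embedded submanifold these are its topology and its smooth functions. *)
Definition rel_open (G W : set V) : Prop :=
  exists2 O : set V, open O & W = G `&` O.

Definition rel_smooth (W : set V) (f : V -> R^o) : Prop :=
  forall g, W g -> exists (O : set V) (F : V -> R^o),
    [/\ open O, O g, smooth_on O F & forall h, W h -> O h -> F h = f h].

End SmoothFunctions.

(* The smooth structure of a homogeneous space.  Let G be a closed subgroup of
   GL_n(R) (hence an embedded submanifold of the space of matrices) acting
   transitively on M by [act].  The manifold structure transported to M from
   G / Stab(x) is the one making the orbit map g |-> g.x a surjective
   submersion: U is open in M, resp. f is smooth on the open set U, iff its
   pullback along the orbit map is open, resp. smooth.  It does not depend on
   the base point x, so the conditions are stated for all of them. *)
Section HomogeneousSpaces.
Context {R : realType} {n : nat} (G : set 'M[R]_n.+1).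

Section Structure.
Context {T : Type} (act : 'M[R]_n.+1 -> T -> T) (M : set T).

Definition hs_open (U : set T) : Prop :=
  U `<=` M /\
  forall x, M x -> rel_open G (G `&` [set g | U (act g x)]).

Definition hs_smooth (U : set T) (f : T -> R^o) : Prop :=
  forall x, M x ->
    rel_smooth (G `&` [set g | U (act g x)]) (fun g => f (act g x)).

End Structure.

(* A map of manifolds is smooth iff it is continuous and pulls back locally
   defined smooth functions to smooth functions. *)
Definition hs_smooth_map {T T' : Type}
    (act : 'M[R]_n.+1 -> T -> T) (M : set T)
    (act' : 'M[R]_n.+1 -> T' -> T') (M' : set T') (phi : T -> T') : Prop :=
  [/\ forall x, M x -> M' (phi x),
      forall U, hs_open act' M' U -> hs_open act M (M `&` phi @^-1` U)
    & forall U f, hs_open act' M' U -> hs_smooth act' M' U f ->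
        hs_smooth act M (M `&` phi @^-1` U) (f \o phi)].

Definition G_isomorphic {T T' : Type}
    (act : 'M[R]_n.+1 -> T -> T) (M : set T)
    (act' : 'M[R]_n.+1 -> T' -> T') (M' : set T') : Prop :=
  exists (phi : T -> T') (psi : T' -> T),
    [/\ hs_smooth_map act M act' M' phi,
        hs_smooth_map act' M' act M psi,
        forall x, M x -> psi (phi x) = x,
        forall y, M' y -> phi (psi y) = y
      & forall g x, G g -> M x -> phi (act g x) = act' g (phi x)].

End HomogeneousSpaces.

Section DeSitter.
Context (R : realType).

Definition minkowski_mx : 'M[R]_5 :=
  diag_mx (\row_(j < 5) (if j == 0 then -1 else 1)).

Definition minkowski (x y : 'cV[R]_5) : R :=
  (x^T *m minkowski_mx *m y) 0 0.

Definition linear_isometries : set 'M[R]_5 :=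
  [set A | A \in unitmx /\
           forall x y, minkowski (A *m x) (A *m y) = minkowski x y].

Definition SOo41 : set 'M[R]_5 := connected_component linear_isometries 1%:M.

Definition deSitter : set 'cV[R]_5 := [set x | minkowski x x = 1].

Definition cosh (t : R) : R := (expR t + expR (- t)) / 2.
Definition sinh (t : R) : R := (expR t - expR (- t)) / 2.

Definition geodesic (x u : 'cV[R]_5) (t : R) : 'cV[R]_5 :=
  cosh t *: x + sinh t *: u.

(* Inertial observers are unparametrized: the set of events on the geodesic. *)
Definition inertial_observers : set (set 'cV[R]_5) :=
  [set c | exists x u : 'cV[R]_5,
    [/\ deSitter x, minkowski u u = -1, 0 < u 0 0, minkowski x u = 0
      & c = range (geodesic x u)]].

Definition observer_act (g : 'M[R]_5) (c : set 'cV[R]_5) : set 'cV[R]_5 :=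
  mulmx g @` c.

Definition projective_light_cone : set {vspace 'cV[R]_5} :=
  [set L | \dim L = 1%N /\ forall v, v \in L -> minkowski v v = 0].

Definition line_act (g : 'M[R]_5) (L : {vspace 'cV[R]_5}) :
    {vspace 'cV[R]_5} :=
  (linfun (mulmx g) @: L)%VS.

Definition distinct_pairs : set ({vspace 'cV[R]_5} * {vspace 'cV[R]_5}) :=
  [set p | [/\ projective_light_cone p.1, projective_light_cone p.2
             & p.1 <> p.2]].

Definition pair_act (g : 'M[R]_5)
    (p : {vspace 'cV[R]_5} * {vspace 'cV[R]_5}) :
    {vspace 'cV[R]_5} * {vspace 'cV[R]_5} :=
  (line_act g p.1, line_act g p.2).

End DeSitter.

Arguments SOo41 R : clear implicits.
Arguments inertial_observers R : clear implicits.
Arguments distinct_pairs R : clear implicits.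
Arguments observer_act R : clear implicits.
Arguments pair_act R : clear implicits.

(* Main.v *)
(* An observer {s p + s^-1 q | s > 0} is determined by the null vectors
   p = (x + u) / 2 and q = (x - u) / 2, unique up to (p, q) -> (a p, a^-1 q)
   with a > 0; the same ambiguity remains when the ordered pair of null lines
   ([p], [q]) is given, with p future, q past and eta(p, q) = 1/2.  Both spaces
   are thus the same quotient of the set of such pairs (p, q), on which G acts
   because its elements preserve the time orientation, by connectedness.  For
   the quotient manifold structures every equivariant map is smooth. *)
Require Import Defs.
From mathcomp Require Import all_boot all_order all_algebra.
From mathcomp Require Import all_classical all_reals all_analysis.
From mathcomp Require Import ring lra.

Set Implicit Arguments.
Unset Strict Implicit.
Unset Printing Implicit Defensive.

Import Order.TTheory GRing.Theory Num.Theory.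
Import numFieldNormedType.Exports.

Local Open Scope classical_set_scope.
Local Open Scope ring_scope.

(** * Equivariant maps of homogeneous spaces *)

(** Openness and smoothness are tested along orbit maps, and by equivariance [phi] carries the orbit
    map at [x] to the one at [phi x]. The condition to check at [x] is thus the given one at
    [phi x]. *)
Lemma equivariant_hs_smooth_map (R : realType) (n : nat) (G : set 'M[R]_n.+1)
    (T T' : Type) (act : 'M[R]_n.+1 -> T -> T) (M : set T)
    (act' : 'M[R]_n.+1 -> T' -> T') (M' : set T') (phi : T -> T') :
  (forall g x, G g -> M x -> M (act g x)) ->
  (forall x, M x -> M' (phi x)) ->
  (forall g x, G g -> M x -> phi (act g x) = act' g (phi x)) ->
  hs_smooth_map G act M act' M' phi.
Proof.
move=> actM phiM phiE.
have pullE U x : M x -> G `&` [set g | (M `&` phi @^-1` U) (act g x)]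
    = G `&` [set g | U (act' g (phi x))].
  move=> Mx; apply/seteqP; split=> g /= [Gg].
    by rewrite phiE // => -[].
  by move=> Ug; split=> //; split; [exact: actM | rewrite phiE].
split=> // [U [_ oU]|U f [_ oU] sf].
  split=> [x []//|x Mx]; rewrite pullE //; exact/oU/phiM.
move=> x Mx; rewrite pullE // => g Wg.
have [N [F [oN Ng sF FE]]] := sf _ (phiM _ Mx) g Wg.
exists N, F; split=> // h Wh Nh.
by rewrite FE //= phiE //; case: Wh.
Qed.

(* Unqualified, the name denotes Minkowski's inequality of [hoelder]. *)
Local Notation minkowski := Defs.minkowski.

(** * The Minkowski form and null vectors *)

Section Minkowski.
Variable R : realType.
Implicit Types (v w p q : 'cV[R]_5) (F : 'cV[R]_5 * 'cV[R]_5) (A : 'M[R]_5).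

Lemma minkowskiE v w : minkowski v w =
  - (v 0 0 * w 0 0) + \sum_(i < 4) v (lift 0 i) 0 * w (lift 0 i) 0.
Proof.
rewrite /minkowski /minkowski_mx mul_mx_diag mxE big_ord_recl !mxE /= mulrN1.
rewrite mulNr; congr (_ + _); apply: eq_bigr => i _.
by rewrite !mxE /= mulr1.
Qed.

Lemma minkowskiC v w : minkowski v w = minkowski w v.
Proof.
by rewrite !minkowskiE mulrC; under eq_bigr do rewrite mulrC.
Qed.

Lemma minkowskiDl v w p : minkowski (v + w) p = minkowski v p + minkowski w p.
Proof. by rewrite /minkowski linearD /= !mulmxDl mxE. Qed.

Lemma minkowskiZl (a : R) v w : minkowski (a *: v) w = a * minkowski v w.
Proof. by rewrite /minkowski linearZ /= -!scalemxAl mxE. Qed.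

Lemma minkowskiDr v w p : minkowski p (v + w) = minkowski p v + minkowski p w.
Proof. by rewrite minkowskiC minkowskiDl !(minkowskiC p). Qed.

Lemma minkowskiZr (a : R) v w : minkowski w (a *: v) = a * minkowski w v.
Proof. by rewrite minkowskiC minkowskiZl minkowskiC. Qed.

Lemma minkowskiNl v w : minkowski (- v) w = - minkowski v w.
Proof. by rewrite -scaleN1r minkowskiZl mulN1r. Qed.

Lemma minkowskiNr v w : minkowski v (- w) = - minkowski v w.
Proof. by rewrite minkowskiC minkowskiNl minkowskiC. Qed.

Lemma minkowski0l v : minkowski 0 v = 0.
Proof. by rewrite -(scale0r 0) minkowskiZl mul0r. Qed.

Definition minkowski_bilin := (minkowskiDl, minkowskiDr, minkowskiNl,
  minkowskiNr, minkowskiZl, minkowskiZr).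

Lemma minkowski_spacelike v : v 0 0 = 0 ->
  0 <= minkowski v v /\ (minkowski v v = 0 -> v = 0).
Proof.
move=> v0; rewrite minkowskiE v0 mulr0 oppr0 add0r; split.
  by apply: sumr_ge0 => i _; rewrite -expr2 sqr_ge0.
move=> /psumr_eq0P vi0; apply/matrixP => i j; rewrite ord1 mxE.
case: (unliftP 0 i) => [k ->|->//]; apply/eqP; rewrite -sqrf_eq0 expr2.
by apply/eqP/vi0 => // l _; rewrite -expr2 sqr_ge0.
Qed.

Lemma null_time_neq0 v : minkowski v v = 0 -> v != 0 -> v 0 0 != 0.
Proof.
by move=> vv; apply: contra_neq => /minkowski_spacelike[_]; exact.
Qed.

(* [w 0 0 *: v - v 0 0 *: w] is spacelike or zero. *)
Lemma null_minkowski v w : minkowski v v = 0 -> minkowski w w = 0 ->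
  v 0 0 * w 0 0 * minkowski v w <= 0 /\
  (minkowski v w = 0 -> w 0 0 *: v = v 0 0 *: w).
Proof.
move=> vv ww; set z := w 0 0 *: v - v 0 0 *: w.
have z0 : z 0 0 = 0 by rewrite !mxE mulrC subrr.
have zz : minkowski z z = - 2 * (v 0 0 * w 0 0 * minkowski v w).
  by rewrite !minkowski_bilin vv ww (minkowskiC w v); ring.
have [zge0 z_eq0] := minkowski_spacelike z0; split; first by lra.
move=> vw; apply/subr0_eq/z_eq0; rewrite zz vw; ring.
Qed.

(** * Null frames over observers and over pairs of null lines *)

(** The value [2^-1] gives every [s *: F.1 + s^-1 *: F.2] with [s != 0] norm 1, so that it lies in
    de Sitter space. *)
Definition null_frame : set ('cV[R]_5 * 'cV[R]_5) := [set F |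
  [/\ minkowski F.1 F.1 = 0, minkowski F.2 F.2 = 0,
      minkowski F.1 F.2 = 2^-1, 0 < F.1 0 0 & F.2 0 0 < 0]].

Definition worldline F : set 'cV[R]_5 :=
  [set s *: F.1 + s^-1 *: F.2 | s in [set s : R | 0 < s]].

Definition null_lines F : {vspace 'cV[R]_5} * {vspace 'cV[R]_5} :=
  (<[F.1]>%VS, <[F.2]>%VS).

(** The parameters correspond by [s = expR t]: [cosh] and [sinh] are split into their
    exponentials. *)
Lemma geodesic_worldline v w :
  range (geodesic v w) = worldline (2^-1 *: (v + w), 2^-1 *: (v - w)).
Proof.
have gE (t : R) : geodesic v w t =
    expR t *: (2^-1 *: (v + w)) + (expR t)^-1 *: (2^-1 *: (v - w)).
  rewrite /geodesic /cosh /sinh expRN; apply/matrixP => i j; rewrite !mxE.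
  by field; rewrite gt_eqF ?expR_gt0.
apply/seteqP; split=> z /=.
  by move=> [t _ <-]; exists (expR t); rewrite ?gE //= expR_gt0.
by move=> [s s0 <-]; exists (ln s) => //; rewrite gE lnK.
Qed.

Lemma inertial_observersE : inertial_observers R = worldline @` null_frame.
Proof.
apply/seteqP; split=> c /=.
  move=> [x [u [xx uu u0 xu ->]]]; rewrite geodesic_worldline.
  set p := 2^-1 *: (x + u); set q := 2^-1 *: (x - u).
  have ux : minkowski u x = 0 by rewrite minkowskiC.
  have pp : minkowski p p = 0 by rewrite !minkowski_bilin xx uu xu ux; lra.
  have qq : minkowski q q = 0 by rewrite !minkowski_bilin xx uu xu ux; lra.
  have pq : minkowski p q = 2^-1 by rewrite !minkowski_bilin xx uu xu ux; lra.
  have p0 : p 0 0 != 0.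
    apply: null_time_neq0 => //; apply: contra_eq_neq pq => ->.
    by rewrite minkowski0l; lra.
  have q0 : q 0 0 != 0.
    apply: null_time_neq0 => //; apply: contra_eq_neq pq => ->.
    by rewrite minkowskiC minkowski0l; lra.
  (* A positive product forces the time coordinates of [p] and [q] to have opposite signs;
     [u = p - q] being future decides which is positive. *)
  have [pq0 _] := null_minkowski pp qq; rewrite pq in pq0.
  have up : u 0 0 = p 0 0 - q 0 0 by rewrite !mxE; field.
  exists (p, q) => //; split=> //=.
    by rewrite lt_neqAle eq_sym p0 /=; nra.
  by rewrite lt_neqAle q0 /=; nra.
move=> [[p q] [/= pp qq pq p0 q0] <-]; exists (p + q), (p - q).
have qp : minkowski q p = 2^-1 by rewrite minkowskiC.
split.
- by rewrite /deSitter /= !minkowski_bilin pp qq pq qp; lra.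
- by rewrite !minkowski_bilin pp qq pq qp; lra.
- by rewrite !mxE; lra.
- by rewrite !minkowski_bilin pp qq pq qp; lra.
- rewrite geodesic_worldline; congr worldline.
  by congr pair; apply/matrixP => i j; rewrite !mxE; field.
Qed.

Lemma vline_scale (a : R) v : a != 0 -> (<[a *: v]> = <[v]>)%VS.
Proof.
move=> a0; apply/eqP; rewrite eqEsubv -!memvE memvZ ?memv_line //=.
by apply/vlineP; exists a^-1; rewrite scalerA mulVf // scale1r.
Qed.

(** A nonzero null vector has nonzero time coordinate, so a generator can be rescaled to time 1. *)
Lemma null_line_vector (L : {vspace 'cV[R]_5}) : projective_light_cone L ->
  exists v, [/\ L = <[v]>%VS, minkowski v v = 0 & v 0 0 = 1].
Proof.
move=> [dL Lnull].
have v0 : vpick L != 0 by rewrite vpick0 -dimv_eq0 dL.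
have LE : L = <[vpick L]>%VS.
  by apply/esym/eqP; rewrite eqEdim -memvE memv_pick dim_vline v0 dL.
have vv := Lnull _ (memv_pick L); have t0 := null_time_neq0 vv v0.
exists ((vpick L 0 0)^-1 *: vpick L); split.
- by rewrite vline_scale ?invr_eq0.
- by rewrite !minkowski_bilin vv !mulr0.
- by rewrite mxE mulVf.
Qed.

Lemma null_line_light_cone v :
  minkowski v v = 0 -> v != 0 -> projective_light_cone <[v]>%VS.
Proof.
move=> vv v0; split; first by rewrite dim_vline v0.
by move=> _ /vlineP[a ->]; rewrite !minkowski_bilin vv !mulr0.
Qed.

Lemma distinct_pairsE : distinct_pairs R = null_lines @` null_frame.
Proof.
apply/seteqP; split=> [[L L']|_ [[p q] [/= pp qq pq p0 q0] <-]] /=.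
  move=> [/= /null_line_vector[v [-> vv v0]] /null_line_vector[w [-> ww w0]] vw].
  have [le0 eq0] := null_minkowski vv ww; rewrite v0 w0 !scale1r !mul1r in le0 eq0.
  (* Both times being 1, a vanishing product would give [v = w], hence equal lines. *)
  have m0 : minkowski v w < 0.
    by rewrite lt_neqAle le0 andbT; apply/eqP => /eq0 E; apply: vw; rewrite E.
  (* The factor [- 1] turns [w] to the past; the factor of [v], positive by [m0], then normalizes
     the product to [2^-1]. *)
  exists ((- (2 * minkowski v w)^-1) *: v, (- 1) *: w).
    split; rewrite /= ?minkowski_bilin ?vv ?ww ?mulr0 ?mxE ?v0 ?w0 ?mulr1 //.
    - by field; rewrite lt_eqF.
    - by rewrite oppr_gt0 invr_lt0; lra.
  rewrite /null_lines /= !vline_scale // ?oppr_eq0 ?oner_eq0 //.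
  by rewrite invr_eq0 mulf_neq0 ?pnatr_eq0 // lt_eqF.
have nz v : v 0 0 != 0 -> v != 0 by apply: contra_neq => ->; rewrite mxE.
split=> /=.
- by apply: null_line_light_cone; rewrite // nz ?gt_eqF.
- by apply: null_line_light_cone; rewrite // nz ?lt_eqF.
- move=> pqE; have /vlineP[a qE] : p \in <[q]>%VS by rewrite -pqE memv_line.
  by move: pq; rewrite qE minkowskiZl qq; lra.
Qed.

(** * The two maps on null frames have the same fibres *)

Lemma worldline_span F p q : worldline F = worldline (p, q) ->
  exists a b c d : R, F.1 = a *: p + b *: q /\ F.2 = c *: p + d *: q.
Proof.
move: F => [p' q'] E.
have on s : 0 < s -> worldline (p, q) (s *: p' + s^-1 *: q').
  by move=> s0; rewrite -E; exists s.
have [s _ /= sE] := on 1 ltr01.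
have [t _ /= tE] := on 2 (ltr0Sn _ 1).
have coordE i j : p' i j + q' i j = s * p i j + s^-1 * q i j /\
    2 * p' i j + 2^-1 * q' i j = t * p i j + t^-1 * q i j.
  split.
    by move/matrixP: sE => /(_ i j); rewrite !mxE invr1 !mul1r.
  by move/matrixP: tE => /(_ i j); rewrite !mxE.
(* With [f s = s *: p' + s^-1 *: q'], [3 p' = 2 f(2) - f(1)] and
   [3 q' = 4 f(1) - 2 f(2)]. *)
exists ((2 * t - s) / 3), ((2 * t^-1 - s^-1) / 3).
exists ((4 * s - 2 * t) / 3), ((4 * s^-1 - 2 * t^-1) / 3).
by split; apply/matrixP => i j; rewrite !mxE; have [] := coordE i j; lra.
Qed.

(** The plane of [p] and [q] has only two null directions, so the frames agree up to scaling and a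
    possible swap. A swap would give the opposite branch of the hyperbola, where [s < 0]. *)
Lemma worldline_inj F F' : null_frame F -> null_frame F' ->
  worldline F = worldline F' -> null_lines F = null_lines F'.
Proof.
move=> fF; move: F' => [p q] [/= pp qq pq p0 q0] E.
have [a [b [c [d]]]] := worldline_span E.
have : worldline (p, q) (F.1 + F.2).
  by rewrite -E; exists 1; rewrite /= ?invr1 ?scale1r.
case: F fF {E} => p' q' [/= pp' qq' pq' p0' q0'] [s s0 /= sE] [EP EQ].
subst p' q'.
have qp : minkowski q p = 2^-1 by rewrite minkowskiC.
(* In the basis [p], [q] the form sends [a *: p + b *: q] to [a * b], so nullity of [p'] and [q']
   kills one coefficient of each. *)
move: pp' qq' pq'; rewrite !minkowski_bilin pp qq pq qp => pp' qq' pq'.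
have ab : a * b = 0 by lra.
have cd : c * d = 0 by lra.
have adbc : a * d + b * c = 1 by lra.
have [b0|b0] := eqVneq b 0.
  subst b; have ad : a * d = 1 by lra.
  have a0 : a != 0 by apply: contra_eq_neq ad => ->; rewrite mul0r eq_sym oner_eq0.
  have d0 : d != 0 by apply: contra_eq_neq ad => ->; rewrite mulr0 eq_sym oner_eq0.
  have c0 : c = 0 by apply/eqP; move/eqP: cd; rewrite mulf_eq0 (negbTE d0) orbF.
  by rewrite /null_lines /= c0 !scale0r addr0 add0r !vline_scale.
have a0 : a = 0 by apply/eqP; move/eqP: ab; rewrite mulf_eq0 (negbTE b0) orbF.
(* Here [p' = b *: q] and [q' = c *: p]; the point [p' + q'] of the worldline
   forces [0 < c], against the time orientation of [p] and [q']. *)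
subst a; have bc : b * c = 1 by lra.
have c0 : c != 0 by apply: contra_eq_neq bc => ->; rewrite mulr0 eq_sym oner_eq0.
have d0 : d = 0 by apply/eqP; move/eqP: cd; rewrite mulf_eq0 (negbTE c0).
subst d; move/(congr1 (fun v => minkowski v q)): sE.
rewrite !minkowski_bilin qq pq => sE.
have cs : c = s by lra.
move: q0'; rewrite !mxE mul0r addr0 cs => sp.
by move: (mulr_gt0 s0 p0); rewrite ltNge ltW.
Qed.

(** The frames differ by [(p, q)] to [(a p, a^-1 q)], with [a > 0] as both first vectors are future;
    this only reparametrizes [s] to [s * a]. *)
Lemma null_lines_inj F F' : null_frame F -> null_frame F' ->
  null_lines F = null_lines F' -> worldline F = worldline F'.
Proof.
suff sub : forall F F', null_frame F -> null_frame F' ->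
    null_lines F = null_lines F' -> worldline F `<=` worldline F'.
  by move=> fF fF' E; apply/seteqP; split; apply: sub.
move=> {F F'} [p' q'] [p q] [/= pp' qq' pq' p0' q0'] [/= pp qq pq p0 q0] E.
have /vlineP[a p'E] : p' \in <[p]>%VS.
  by rewrite -[<[p]>%VS](congr1 fst E) memv_line.
have /vlineP[d q'E] : q' \in <[q]>%VS.
  by rewrite -[<[q]>%VS](congr1 snd E) memv_line.
subst p' q'; move: pq' p0'; rewrite !minkowski_bilin pq mxE => pq' p0'.
have a0 : 0 < a by rewrite pmulr_lgt0 in p0'.
have dE : d = a^-1.
  by apply: (mulfI (lt0r_neq0 a0)); rewrite divff ?lt0r_neq0 //; lra.
move=> _ [s /= s0 <-]; exists (s * a); first exact: mulr_gt0.
by rewrite /= dE !scalerA invfM.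
Qed.

(** * Time orientation and the action on null frames *)

(** The time coordinate of [B *m v] is continuous in [B] and never zero on a connected set of
    isometries, since [B *m v] stays null and nonzero. It is positive at the identity, hence at
    [A]. *)
Lemma SOo41_future A v : SOo41 R A ->
  minkowski v v = 0 -> 0 < v 0 0 -> 0 < (A *m v) 0 0.
Proof.
move=> [C [C1 sC cC] CA] vv v0.
pose f (B : 'M[R]_5) : R := (B *m v) 0 0.
have fcont : continuous f.
  have -> : f = fun B : 'M[R]_5 => \sum_j B 0 j * v j 0.
    by apply/funext => B; rewrite /f mxE.
  apply: continuous_big => [|j _ B]; first exact: add_continuous.
  exact: cvgM (@coord_continuous _ _ _ 0 j B) (cvg_cst _).
have cfC : connected (f @` C).
  by apply: connected_continuous_connected => //; exact: continuous_subspaceT.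
have f_neq0 B : C B -> f B != 0.
  move=> /sC[Bu Biso]; apply: null_time_neq0; first by rewrite Biso.
  apply: contraTneq v0 => Bv0; have : v = invmx B *m (B *m v) by rewrite mulKmx.
  by rewrite Bv0 mulmx0 => ->; rewrite mxE ltxx.
have fA : f A != 0 := f_neq0 _ CA.
rewrite lt_neqAle eq_sym fA /= leNgt; apply/negP => fA0.
have /connected_intervalP itv := cfC.
have [B CB fB] : (f @` C) 0.
  apply: (itv (f A) (f 1%:M)); [by exists A | by exists 1%:M |].
  by rewrite (ltW fA0) /= /f mul1mx ltW.
by move: (f_neq0 B CB); rewrite fB eqxx.
Qed.

Definition frame_act A F := (A *m F.1, A *m F.2).

Lemma frame_act_null_frame A F :
  SOo41 R A -> null_frame F -> null_frame (frame_act A F).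
Proof.
move=> GA [pp qq pq p0 q0].
have [_ iso] : linear_isometries A by exact: connected_component_sub GA.
split; rewrite /= ?iso //; first exact: SOo41_future.
(* [F.2] is past, so the future case is applied to its opposite. *)
have : 0 < (A *m - F.2) 0 0.
  apply: SOo41_future => //.
    by rewrite !minkowski_bilin qq !oppr0.
  by rewrite mxE oppr_gt0.
by rewrite mulmxN mxE oppr_gt0.
Qed.

Lemma observer_act_worldline A F :
  observer_act R A (worldline F) = worldline (frame_act A F).
Proof.
rewrite /observer_act /worldline image_comp; apply: eq_imagel => s _ /=.
by rewrite mulmxDr -!scalemxAr.
Qed.

Lemma pair_act_null_lines A F :
  pair_act R A (null_lines F) = null_lines (frame_act A F).
Proof. by rewrite /pair_act /line_act !limg_line !lfunE. Qed.

End Minkowski.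

Theorem proposition1 (R : realType) :
  G_isomorphic (SOo41 R)
    (observer_act R) (inertial_observers R)
    (pair_act R) (distinct_pairs R).
Proof.
rewrite inertial_observersE distinct_pairsE.
(* Both maps choose a null frame over the given point; [worldline_inj] and [null_lines_inj] make the
   result independent of the choice. *)
pose phi c := null_lines (get [set F | @null_frame R F /\ worldline F = c]).
pose psi y := worldline (get [set F | @null_frame R F /\ null_lines F = y]).
have phiE F : null_frame F -> phi (worldline F) = null_lines F.
  move=> fF; pose P := [set F' | null_frame F' /\ worldline F' = worldline F].
  have [fF' /(worldline_inj fF' fF) //] : P (get P) by apply: getPex; exists F.
have psiE F : null_frame F -> psi (null_lines F) = worldline F.
  move=> fF; pose P := [set F' | null_frame F' /\ null_lines F' = null_lines F].
  have [fF' /(null_lines_inj fF' fF) //] : P (get P) by apply: getPex; exists F.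
exists phi, psi; split.
- apply: equivariant_hs_smooth_map =>
    [g _ Gg [F fF <-]|_ [F fF <-]|g _ Gg [F fF <-]].
  + rewrite observer_act_worldline; exists (frame_act g F) => //.
    exact: frame_act_null_frame.
  + by rewrite phiE //; exists F.
  + have fgF := frame_act_null_frame Gg fF.
    by rewrite observer_act_worldline !phiE // pair_act_null_lines.
- apply: equivariant_hs_smooth_map =>
    [g _ Gg [F fF <-]|_ [F fF <-]|g _ Gg [F fF <-]].
  + rewrite pair_act_null_lines; exists (frame_act g F) => //.
    exact: frame_act_null_frame.
  + by rewrite psiE //; exists F.
  + have fgF := frame_act_null_frame Gg fF.
    by rewrite pair_act_null_lines !psiE // observer_act_worldline.
- by move=> _ [F fF <-]; rewrite phiE // psiE.
- by move=> _ [F fF <-]; rewrite psiE // phiE.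
- move=> g _ Gg [F fF <-]; have fgF := frame_act_null_frame Gg fF.
  by rewrite observer_act_worldline !phiE // pair_act_null_lines.
Qed.
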